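(* For each positive integer $m$, the complete bipartite graph $K_{m,m}$ is not proportionally $m$-choosable.
   Context: All graphs are finite and simple. For a positive integer $k$, a $k$-assignment $L$ for a graph $G$ assigns to each vertex $v$ a set $L(v)$ of exactly $k$ colors; its palette is $\mathcal{L} = \bigcup_{v \in V(G)} L(v)$, and for $c \in \mathcal{L}$, $\eta(c) = |\{v \in V(G) : c \in L(v)\}|$. A proper $L$-coloring of $G$ is a proper coloring $f$ of $G$ with $f(v) \in L(v)$ for every vertex $v$. It is a proportional $L$-coloring if for every $c \in \mathcal{L}$, $|f^{-1}(c)|$ equals $\lfloor \eta(c)/k \rfloor$ or $\lceil \eta(c)/k \rceil$. $G$ is proportionally $k$-choosable if a proportional $L$-coloring of $G$ exists for every $k$-assignment $L$ for $G$. *)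

(* Defs.v *)
From mathcomp Require Import all_boot.
Set Implicit Arguments.
Unset Strict Implicit.
Unset Printing Implicit Defensive.

Record sgraph := SGraph {
  vertex :> finType;
  adj : rel vertex;
  adj_sym : symmetric adj;
  adj_irrefl : irreflexive adj }.

Section CompleteBipartite.
Variables m n : nat.

Definition Kbip_adj : rel ('I_m + 'I_n) :=
  fun u v => match u, v with
             | inl _, inr _ | inr _, inl _ => true
             | _, _ => false
             end.

Lemma Kbip_adj_sym : symmetric Kbip_adj. Proof. by case=> [x|x] [y|y]. Qed.
Lemma Kbip_adj_irrefl : irreflexive Kbip_adj. Proof. by case. Qed.

Definition Kbip : sgraph := SGraph Kbip_adj_sym Kbip_adj_irrefl.
End CompleteBipartite.

(* The ceiling of n / k, for k > 0; the floor is [n %/ k]. *)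
Definition ceil_divn (n k : nat) : nat := (n + k.-1) %/ k.

Lemma ceil_divn_le (n k q : nat) :
  0 < k -> (ceil_divn n k <= q) = (n <= q * k).
Proof.
move=> k0; rewrite /ceil_divn -ltnS ltn_divLR // mulSn addnC.
by rewrite -[X in _ < X + _](prednK k0) addSn ltnS leq_add2l.
Qed.

Section ListColoring.
Variables (G : sgraph) (C : finType).

Definition kassignment (k : nat) (L : G -> {set C}) : Prop :=
  forall v, #|L v| = k.

Definition palette (L : G -> {set C}) : {set C} := \bigcup_(v : G) L v.

Definition eta (L : G -> {set C}) (c : C) : nat := #|[set v : G | c \in L v]|.

Definition proper_coloring (f : G -> C) : Prop :=
  forall u v : G, adj u v -> f u <> f v.

Definition proper_Lcoloring (L : G -> {set C}) (f : G -> C) : Prop :=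
  proper_coloring f /\ forall v, f v \in L v.

Definition proportional_Lcoloring (k : nat) (L : G -> {set C}) (f : G -> C) :
    Prop :=
  proper_Lcoloring L f /\
  forall c, c \in palette L ->
    #|f @^-1: [set c]| = eta L c %/ k \/
    #|f @^-1: [set c]| = ceil_divn (eta L c) k.
End ListColoring.

(* As G is finite, so is the palette of any k-assignment; letting C range over
   all finite types therefore covers assignments with arbitrary colors. *)
Definition proportionally_choosable (k : nat) (G : sgraph) : Prop :=
  forall (C : finType) (L : G -> {set C}),
    kassignment k L -> exists f : G -> C, proportional_Lcoloring k L f.

(* Main.v *)
Require Import Defs.
From mathcomp Require Import all_boot.

(**
  All lists on one side are {c, a_1, ..., a_(m-1)}, and all lists on the other
  side are {c, b_1, ..., b_(m-1)}. Each a_i and each b_i lies in exactly m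
  lists, so a proportional coloring uses it only once. Hence each side, having
  m vertices, must also use c, and then the two vertices colored c are adjacent.
*)

(** If [c] is in the palette, the floor and the ceiling of [eta L c / k] are both at most 1;
    otherwise no list offers [c], so its preimage is empty. *)
Lemma proportional_preim_le1 (G : sgraph) (C : finType) (k : nat)
    (L : G -> {set C}) (f : G -> C) (c : C) :
  0 < k -> proportional_Lcoloring k L f -> eta L c <= k ->
  #|f @^-1: [set c]| <= 1.
Proof.
move=> k0 [[_ fL] fprop] etac.
have [cL|cL] := boolP (c \in palette L); last first.
  rewrite leqNgt; apply/negP => /ltnW/card_gt0P[v]; rewrite !inE => /eqP fv.
  by case/negP: cL; apply/bigcupP; exists v; rewrite // -fv.
have ceil1 : ceil_divn (eta L c) k <= 1 by rewrite ceil_divn_le // mul1n.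
case: (fprop c cL) => -> //.
by apply: leq_trans ceil1; rewrite leq_div2r // leq_addr.
Qed.

Definition side_vertex (m : nat) (b : bool) (i : 'I_m) : Kbip m m :=
  if b then inl i else inr i.

Definition side (m : nat) (v : Kbip m m) : bool :=
  if v is inl _ then true else false.

(* [None] is the color c common to all lists. *)
Definition private_colors (n : nat) (b : bool) : {set option (bool * 'I_n)} :=
  [set Some (b, i) | i : 'I_n].

Definition side_lists (m n : nat) (v : Kbip m m) : {set option (bool * 'I_n)} :=
  None |: private_colors n (side m v).

Lemma side_vertex_inj (m : nat) (b : bool) : injective (side_vertex m b).
Proof. by case: b => i j []. Qed.

Lemma side_vertexK (m : nat) (b : bool) (i : 'I_m) :
  side m (side_vertex m b i) = b.
Proof. by case: b. Qed.

Lemma card_private_colors (n : nat) (b : bool) : #|private_colors n b| = n.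
Proof. by rewrite card_imset ?card_ord // => i j []. Qed.

Lemma card_side_lists (m n : nat) (v : Kbip m m) : #|side_lists m n v| = n.+1.
Proof.
rewrite /side_lists cardsU1 card_private_colors.
by case: imsetP => // -[].
Qed.

(** Only vertices of side [b] have [Some (b, j)] in their list, and that side has [m] vertices. *)
Lemma eta_side_lists (m n : nat) (b : bool) (j : 'I_n) :
  eta (side_lists m n) (Some (b, j)) <= m.
Proof.
rewrite -[leqRHS]card_ord -cardsT -(card_imset _ (side_vertex_inj m b)).
apply/subset_leq_card/subsetP => v; rewrite !inE /= => /imsetP[i _ [-> _]].
by case: v => k; apply/imsetP; exists k.
Qed.

(** Pigeonhole: if side [b] avoided [None], its [n.+1] vertices would get distinct colors among only
    [n] private ones. *)
Lemma side_uses_common_color (n : nat) (b : bool)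
    (f : Kbip n.+1 n.+1 -> option (bool * 'I_n)) :
  proportional_Lcoloring n.+1 (side_lists n.+1 n) f ->
  exists i, f (side_vertex n.+1 b i) = None.
Proof.
move=> fprop; set g := fun i => f (side_vertex n.+1 b i).
have [/existsP[i /eqP gi]|/existsPn gN] := boolP [exists i, g i == None].
  by exists i.
have g_private i : g i \in private_colors n b.
  have := fprop.1.2 (side_vertex n.+1 b i).
  by rewrite /side_lists side_vertexK in_setU1 (negPf (gN i)).
(* Two vertices sharing a private color would both lie in a preimage of size at most 1. *)
have g_inj : injective g.
  move=> i i' gii'; apply: (@side_vertex_inj _ b).
  have /imsetP[j _ gi] := g_private i.
  have /card_le1_eqP := proportional_preim_le1 _ _ _ _ _ _ (ltn0Sn n) fprop
    (eta_side_lists n.+1 n b j).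
  by apply; rewrite !inE -gi; apply/eqP.
have /subset_leq_card : g @: [set: 'I_n.+1] \subset private_colors n b.
  by apply/subsetP => _ /imsetP[i _ ->].
by rewrite card_imset // cardsT card_ord card_private_colors ltnn.
Qed.

Theorem proposition28 (m : nat) (hm : 0 < m) :
  ~ proportionally_choosable m (Kbip m m).
Proof.
(* With [m = n.+1], each side has [n] private colors, so that adding [None] gives lists of size
   [m]. *)
case: m hm => // n _ choosable.
have [f fprop] := choosable _ _ (card_side_lists n.+1 n).
have [i fi] := side_uses_common_color n true f fprop.
have [j fj] := side_uses_common_color n false f fprop.
have := fprop.1.1 (inl i) (inr j) isT; rewrite /= in fi fj.
by rewrite fi fj.
Qed.
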